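(* Let $k$ be a field and let $M$ be a matroid (possibly infinite). Then $M$ arises as a thin sums matroid over a thin family for the field $k$ (that is, $M = M_{ts}(f)$ for some set $A$ and some thin family $f\colon E \to k^A$, where $E$ is the ground set of $M$) if and only if $M$ is the dual of a $k$-representable matroid.
   Context: A matroid $M$ consists of a (possibly infinite) ground set $E$ and a set $\mathcal I$ of subsets of $E$ (the independent sets) such that: (I1) $\emptyset\in\mathcal I$; (I2) $\mathcal I$ is closed under taking subsets; (I3) for every non-maximal $I\in\mathcal I$ and every maximal $I'\in\mathcal I$ there is $x\in I'\setminus I$ with $I\cup\{x\}\in\mathcal I$; (IM) whenever $I\subseteq X\subseteq E$ and $I\in\mathcal I$, the set $\{I'\in\mathcal I : I\subseteq I'\subseteq X\}$ has a maximal element. Bases are maximal independent sets. The dual $M^*$ is the matroid on $E$ whose bases are the complements of the bases of $M$. Representable matroids: for a vector space $V$ over $k$ and a map $\phi\colon E\to V$, a linear dependence of $\phi$ is a map $c\colon E\to k$ with $\sum_{e\in E}c(e)\phi(e)=0$, including the requirement that only finitely many summands are nonzero. $M(\phi)$ is the matroid on $E$ in which $E'\subseteq E$ is independent iff there is no nonzero linear dependence of $\phi$ that is zero outside $E'$. A matroid of the form $M(\phi)$ is called $k$-representable. Thin sums: for a set $A$ and a map $f\colon E\to k^A$, a thin dependence of $f$ is a map $c\colon E\to k$ such that for each $a\in A$ we have $\sum_{e\in E}c(e)f(e)(a)=0$ (including the requirement that, for each $a$, only finitely many summands are nonzero). The thin sums system $M_{ts}(f)$ is the set system on $E$ in which a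 subset is independent iff there is no nonzero thin dependence of $f$ that is zero outside that subset; if it is a matroid, it is called a thin sums matroid. The family $f$ is thin if for each $a\in A$ there are only finitely many $e\in E$ with $f(e)(a)\neq 0$. *)

(* Defs.v *)
From mathcomp Require Import all_boot all_algebra.
From mathcomp Require Import all_classical.

Set Implicit Arguments.
Unset Strict Implicit.
Unset Printing Implicit Defensive.

Local Open Scope classical_set_scope.
Local Open Scope ring_scope.

Definition maximal_in (E : Type) (F : set (set E)) (X : set E) : Prop :=
  F X /\ forall Y, F Y -> X `<=` Y -> Y = X.

(* The independence axioms for infinite matroids of Bruhn, Diestel, Kriesell,
   Pendavingh and Wollan, with ground set all of [E]. *)
Record matroid (E : Type) := Matroid {
  indep : set (set E);
  indep_set0 : indep set0;
  indep_subset : forall X Y, X `<=` Y -> indep Y -> indep X;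
  indep_augment : forall X B,
    indep X -> ~ maximal_in indep X -> maximal_in indep B ->
    exists x, [/\ B x, ~ X x & indep (X `|` [set x])];
  indep_maximal : forall X Y, X `<=` Y -> indep X ->
    exists Z, maximal_in [set Z | [/\ indep Z, X `<=` Z & Z `<=` Y]] Z
}.

Definition base (E : Type) (M : matroid E) : set (set E) :=
  maximal_in (indep M).

(* A matroid is determined by its bases, so at most one [M] is the dual of a
   given [N]. *)
Definition is_dual_of (E : Type) (M N : matroid E) : Prop :=
  base M = [set B | base N (~` B)].

Definition indep_of_dependences (k : fieldType) (E : Type)
    (dep : set (E -> k)) : set (set E) :=
  [set X | ~ exists c : E -> k,
    [/\ dep c, c <> cst 0 & forall e, ~ X e -> c e = 0]].

(* Finiteness of the set of nonzero summands is required separately in the next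
   two definitions: [\sum_(e \in _)] is 0 when that set is infinite. *)
Definition linear_dependence (k : fieldType) (E : choiceType) (V : lmodType k)
    (phi : E -> V) : set (E -> k) :=
  [set c | finite_set [set e | c e *: phi e != 0] /\
           \sum_(e \in [set: E]) c e *: phi e = 0].

Definition thin_dependence (k : fieldType) (E : choiceType) (A : Type)
    (f : E -> A -> k) : set (E -> k) :=
  [set c | forall a, finite_set [set e | c e * f e a != 0] /\
                     \sum_(e \in [set: E]) c e * f e a = 0].

Definition linear_indep (k : fieldType) (E : choiceType) (V : lmodType k)
    (phi : E -> V) : set (set E) :=
  indep_of_dependences (linear_dependence phi).

Definition thin_sums_system (k : fieldType) (E : choiceType) (A : Type)
    (f : E -> A -> k) : set (set E) :=
  indep_of_dependences (thin_dependence f).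

Definition thin (k : fieldType) (E A : Type) (f : E -> A -> k) : Prop :=
  forall a, finite_set [set e | f e a != 0].

Definition representable (k : fieldType) (E : choiceType) (M : matroid E) :
    Prop :=
  exists (V : lmodType k) (phi : E -> V), indep M = linear_indep phi.

(* Main.v *)
Require Import Defs.
From mathcomp Require Import all_boot all_algebra.
From mathcomp Require Import all_classical.

Set Implicit Arguments.
Unset Strict Implicit.
Unset Printing Implicit Defensive.

Import GRing.Theory.
Local Open Scope classical_set_scope.
Local Open Scope ring_scope.

(** The two kinds of dependence are orthogonal to each other.  Let [phi : E -> V]
    represent a matroid [N], let [D] be the space of finitely supported linear
    dependences of [phi], and let [annihilator D] be the space of all
    [c : E -> k] that are orthogonal to [D].  The heart of the proof,
    [indep_annihilatorP], is that [X] carries no nonzero [c] in [annihilator D]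
    if and only if the complement of [X] contains a base of [N]; by
    [is_dual_ofP] this says that the sets independent for [annihilator D] are
    exactly those of the dual of [N].

    If a base [B] misses [X], then each [e] in [X] has a fundamental circuit: a
    dependence with value 1 at [e] and supported on [B] together with [e].
    Pairing it with a [c] supported on [X] gives [c e], so [c = 0].  Conversely,
    if the complement of [X] contains no base, extend a maximal independent
    subset [I] of it to a base [B] and pick [e] in both [B] and [X].  The
    function that sends [x] to the coordinate of [phi x] at [e], with respect to
    [B], is in [annihilator D] ([fundamental_cocircuit]); it is 1 at [e], and it
    vanishes on the complement of [X], which is spanned by [I].

    It remains to pass between families.  Given [phi], the members of [D],
    seen as coordinates, form a thin family, and its thin dependences are
    exactly [annihilator D] ([thin_dependence_annihilator]).  Given a thin
    family [f] with space [C] of thin dependences, let [phi e] be the evaluation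
    at [e], a vector of [k^C].  Then [D] consists of the finite [d] orthogonal
    to [C]; as [f] is thin, the functions [fun e => f e a] are among them, so
    everything orthogonal to [D] is a thin dependence and [C = annihilator D]
    ([annihilator_thin_dependence]).  In that direction the matroid axioms for
    [N] are proved from [D] alone ([dependence_matroid]). *)

(** * Finitely supported functions and chains of sets *)

Section FiniteSums.
Variables (k : fieldType) (E : choiceType).

Lemma support_seq (d : E -> k) : finite_set [set e | d e != 0] ->
  exists s : seq E, uniq s /\ forall e, d e != 0 -> e \in s.
Proof.
move=> /finite_seqP[s sE]; exists (undup s); split; first exact: undup_uniq.
move=> e de0; rewrite mem_undup.
by have : [set` s] e by rewrite -sE.
Qed.

Lemma fsum_seq (M : nmodType) (F : E -> M) (s : seq E) :
  uniq s -> (forall e, F e != 0 -> e \in s) ->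
  \sum_(e \in [set: E]) F e = \sum_(e <- s) F e.
Proof.
move=> us Fs; rewrite (fsbigE s) //.
  by apply: eq_bigl => e; rewrite in_setT.
by move=> e _; apply: contraNeq => /Fs.
Qed.

Lemma sum_delta (d : E -> k) (s : seq E) (P : pred E) (x : E) :
  uniq s -> (forall e, d e != 0 -> e \in s) ->
  \sum_(e <- s | P e) d e * (x == e)%:R = if P x then d x else 0.
Proof.
move=> us ds; have [xs|xs] := boolP (x \in s); last first.
  have dx0 : d x = 0 by apply: contraNeq xs => /ds.
  rewrite dx0 if_same big1_seq // => e /andP[_ es].
  by case: eqVneq es xs => [->->//|]; rewrite mulr0.
rewrite big_mkcond (bigD1_seq x) //= eqxx mulr1 big1 ?addr0 // => e ex.
by rewrite eq_sym (negbTE ex) mulr0 if_same.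
Qed.

End FiniteSums.

(** Each element of [s] outside [X] lies in some member of the chain; the
    largest of these finitely many members serves for all of [s].  The value
    [set0] occurs when [X] alone suffices, as it must for an empty chain. *)
Lemma chain_covers_seq (T : eqType) (X : set T) (F : set (set T)) (s : seq T) :
  total_on F subset -> {in s, forall e, (X `|` \bigcup_(Z in F) Z) e} ->
  exists Z, (F Z \/ Z = set0) /\ {in s, forall e, (X `|` Z) e}.
Proof.
move=> totF; elim: s => [|x s IHs] sF; first by exists set0; split=> //; right.
have [|Z [FZ sZ]] := IHs; first by move=> e es; apply: sF; rewrite inE es orbT.
have [Xx|[Z' FZ' Z'x]] := sF x (mem_head _ _).
  exists Z; split=> // e; rewrite inE => /predU1P[->|/sZ //]; by left.
have [ZZ'|Z'Z] : Z `<=` Z' \/ Z' `<=` Z.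
  by case: FZ => [FZ|->]; [exact: totF | left].
  exists Z'; split; first by left.
  move=> e; rewrite inE => /predU1P[->|/sZ]; first by right.
  by case; [left | move/ZZ'; right].
exists Z; split=> // e; rewrite inE => /predU1P[->|/sZ //].
by right; exact: Z'Z.
Qed.

(** * Matroids of spaces of finite dependences *)

Section DependenceSpace.
Variables (k : fieldType) (E : choiceType).
Implicit Types (D : set (E -> k)) (X Y B : set E) (d c : E -> k).

Record dependence_space D : Prop := DependenceSpace {
  dep_finite : forall d, D d -> finite_set [set e | d e != 0];
  dep0 : D (cst 0);
  dep_lin : forall a d d', D d -> D d' -> D (fun e => d e + a * d' e)
}.

(** When [D] is the space of dependences of [phi], this says that [phi e] is in
    the span of [phi] on [Y].  As [d] is prescribed only off [Y], the case where
    [e] is in [Y] needs no separate clause: there [d = 0] will do. *)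
Definition spans D Y e :=
  exists d, D d /\ forall x, ~ Y x -> d x = (x == e)%:R.

Definition annihilator D : set (E -> k) :=
  [set c | forall d, D d -> \sum_(e \in [set: E]) c e * d e = 0].

Lemma indep_dep_eq0 D X d : indep_of_dependences D X -> D d ->
  (forall e, ~ X e -> d e = 0) -> forall e, d e = 0.
Proof.
move=> indX Dd dX e; apply: contrapT => de0; apply: indX; exists d; split=> //.
by move=> d0; apply: de0; rewrite d0.
Qed.

Lemma indep_of_dependences_sub D X Y : X `<=` Y ->
  indep_of_dependences D Y -> indep_of_dependences D X.
Proof.
move=> XY indY [c [Dc c0 cX]]; apply: indY; exists c; split=> // e Ye.
by apply: cX => /XY.
Qed.

Section Space.
Variable D : set (E -> k).
Hypothesis spaceD : dependence_space D.

Let ind := indep_of_dependences D.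

Lemma dep_sum (s : seq E) (P : pred E) (a : E -> k) (h : E -> E -> k) :
  (forall i, P i -> D (h i)) ->
  D (fun x => \sum_(i <- s | P i) a i * h i x).
Proof.
move=> Dh; elim: s => [|i s IHs].
  have -> : (fun x => \sum_(i <- [::] | P i) a i * h i x) = cst 0.
    by apply/funext => x; rewrite big_nil.
  exact: dep0.
have [Pi|NPi] := boolP (P i).
  have := dep_lin spaceD (a i) IHs (Dh _ Pi); congr D.
  by apply/funext => x; rewrite big_cons Pi addrC.
move: IHs; congr D; apply/funext => x.
by rewrite big_cons (negbTE NPi).
Qed.

Lemma spans_mem Y e : Y e -> spans D Y e.
Proof.
move=> Ye; exists (cst 0); split; first exact: dep0.
by move=> x; case: eqVneq => [->|].
Qed.

Lemma spans_mono X Y e : X `<=` Y -> spans D X e -> spans D Y e.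
Proof.
by move=> XY [d [Dd dX]]; exists d; split=> // x Yx; apply: dX => /XY.
Qed.

Lemma spans_choice Y (P : set E) : (forall e, P e -> spans D Y e) ->
  exists h : E -> E -> k, forall e, P e ->
    D (h e) /\ forall x, ~ Y x -> h e x = (x == e)%:R.
Proof.
move=> spP; suff /choice : forall e, exists d, P e ->
    D d /\ forall x, ~ Y x -> d x = (x == e)%:R by move=> [h hP]; exists h.
move=> e; have [/spP[d dP]|NPe] := pselect (P e); first by exists d.
by exists (cst 0).
Qed.

(** Subtracting from [d] the dependences that express the elements of [Y] in
    terms of [X], with coefficients the values of [d], clears [d] on [Y] and
    changes it nowhere else off [X]. *)
Lemma spans_trans X Y e :
  (forall y, Y y -> spans D X y) -> spans D Y e -> spans D X e.
Proof.
move=> spY; have [/spY //|NYe] := pselect (Y e).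
move=> [d [Dd dY]]; have [h hP] := spans_choice spY.
have [s [us ds]] := support_seq (dep_finite spaceD Dd).
exists (fun x => d x + -1 * \sum_(y <- s | y \in Y) d y * h y x); split.
  by apply: dep_lin => //; apply: dep_sum => y /set_mem /hP[].
move=> x NXx; under eq_bigr => y Yy.
  rewrite (proj2 (hP y (set_mem Yy)) x NXx); over.
rewrite sum_delta // mulN1r; case: ifP => [/set_mem Yx|/negbT Yx].
  by rewrite subrr; case: eqVneq => // xe; rewrite -xe in NYe.
by rewrite subr0 dY // => /mem_set; exact/negP.
Qed.

(** A nonzero dependence on [X] plus [x] does not vanish at [x], since [X] is
    independent, and so can be scaled to the value 1 there. *)
Lemma spans_of_dependent X x : ind X -> ~ ind (X `|` [set x]) -> spans D X x.
Proof.
move=> indX /contrapT[d [Dd d0 dX]].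
have [dx0|dx0] := eqVneq (d x) 0.
  exfalso; apply: indX; exists d; split=> // e NXe.
  have [-> //|/eqP ex] := eqVneq e x.
  by apply: dX => -[].
exists (fun e => cst 0 e + (d x)^-1 * d e); split.
  by apply: dep_lin => //; exact: dep0.
move=> e NXe /=; rewrite add0r; have [->|/eqP ex] := eqVneq e x.
  by rewrite mulVf.
by rewrite (dX e) ?mulr0 // => -[].
Qed.

Lemma spans_maximal X Y Z :
  maximal_in [set Z | [/\ ind Z, X `<=` Z & Z `<=` Y]] Z ->
  forall e, Y e -> spans D Z e.
Proof.
move=> [[indZ XZ ZY] maxZ] e Ye.
have [Ze|NZe] := pselect (Z e); first exact: spans_mem.
apply: spans_of_dependent => // indZe; apply: NZe.
rewrite -(maxZ (Z `|` [set e])); first by right.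
  by split=> // [|x [/ZY|->]] //; exact: subset_trans XZ (@subsetUl _ _ _).
exact: subsetUl.
Qed.

Lemma spans_base B : maximal_in ind B -> forall e, spans D B e.
Proof.
move=> [indB maxB] e; apply: (@spans_maximal set0 setT) => //.
split; first by split=> //; exact: sub0set.
by move=> Z [indZ _ _]; exact: maxB.
Qed.

Lemma base_spans X : ind X -> (forall e, spans D X e) -> maximal_in ind X.
Proof.
move=> indX spX; split=> // Y indY XY; apply/seteqP; split=> // y Yy.
apply: contrapT => NXy; have [d [Dd dX]] := spX y.
have : d y = 0.
  apply: (indep_dep_eq0 indY Dd) => e NYe.
  rewrite dX; last by move=> /XY.
  by case: eqVneq NYe => [->|].
by rewrite dX // eqxx => /eqP; rewrite oner_eq0.
Qed.

Lemma dep_set0 : ind set0.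
Proof. by move=> [c [_ c0 cE]]; apply: c0; apply/funext => e; exact: cE. Qed.

(** If no element of [B] could be added to [X], then [X] would span the base
    [B], hence everything, and would itself be maximal. *)
Lemma dep_augment X B : ind X -> ~ maximal_in ind X -> maximal_in ind B ->
  exists x, [/\ B x, ~ X x & ind (X `|` [set x])].
Proof.
move=> indX NmaxX maxB; apply: contrapT => Nx; apply: NmaxX.
apply: base_spans => // e; apply: spans_trans (spans_base maxB e) => b Bb.
have [Xb|NXb] := pselect (X b); first exact: spans_mem.
by apply: spans_of_dependent => // indXb; apply: Nx; exists b.
Qed.

(** Dependences have finite supports, so independence passes to unions of
    chains and Zorn's lemma applies. *)
Lemma dep_maximal X Y : X `<=` Y -> ind X ->
  exists Z, maximal_in [set Z | [/\ ind Z, X `<=` Z & Z `<=` Y]] Z.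
Proof.
move=> XY indX.
(* Ordering the sets [Z] to be added to [X], rather than the sets containing
   [X], makes the union of the empty chain admissible. *)
have [F FP totF|Z [[indXZ ZY] maxZ]] :=
    @Zorn_bigcup E [set Z | ind (X `|` Z) /\ Z `<=` Y].
  split; last by move=> e [Z /FP[_ ZY] /ZY].
  move=> [d [Dd d0 dXF]].
  have [s sE] := proj1 (finite_seqP _) (dep_finite spaceD Dd).
  have [|Z [FZ sZ]] := @chain_covers_seq _ X F s totF.
    move=> e es; apply: contrapT => /dXF de0.
    have : [set` s] e by [].
    by rewrite -sE /= de0 eqxx.
  have : ind (X `|` Z) by case: FZ => [/FP[]//|->]; rewrite setU0.
  apply; exists d; split=> // e NXZe; apply: contrapT => /eqP de0.
  by apply/NXZe/sZ; suff : [set` s] e by []; rewrite -sE.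
exists (X `|` Z); split; first by split=> // e [/XY|/ZY].
move=> W [indW XW WY] XZW; apply: contrapT => WXZ.
apply: (maxZ W); last by rewrite /= (proj2 (setUidPr X W) XW).
split; first by apply: subset_trans XZW; exact: subsetUr.
by move=> WZ; apply: WXZ; apply/seteqP; split=> // e /WZ; right.
Qed.

Definition dependence_matroid : matroid E :=
  Matroid dep_set0 (@indep_of_dependences_sub D) dep_augment dep_maximal.

(** With [h x] a dependence that expresses [x] in terms of [B], the number
    [(e == x)%:R - h x e] is the coordinate of [x] at [e].  It is unique because
    [B] is independent: two dependences that agree off [B] are equal. *)
Lemma fundamental_cocircuit B e : maximal_in ind B -> B e ->
  exists c, [/\ annihilator D c, c e = 1 &
    forall x, spans D (B `\ e) x -> c x = 0].
Proof.
move=> maxB Be; have [indB _] := maxB.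
have [h hP] := @spans_choice B setT (fun x _ => spans_base maxB x).
exists (fun x => (e == x)%:R - h x e); split.
- move=> d Dd; have [s [us ds]] := support_seq (dep_finite spaceD Dd).
  rewrite (fsum_seq us); last first.
    by move=> x; rewrite mulf_eq0 negb_or => /andP[_ /ds].
  (* The pairing with [d] is the value at [e] of [d] minus its expansion in the
     [h y], a dependence supported on [B]. *)
  pose d' x := d x + -1 * \sum_(y <- s) d y * h y x.
  have Dd' : D d'.
    by apply: dep_lin => //; apply: dep_sum => y _; exact: (proj1 (hP y I)).
  have d'0 : d' e = 0.
    apply: (indep_dep_eq0 indB Dd') => x NBx; rewrite /d'.
    under eq_bigr do rewrite (proj2 (hP _ I) x NBx).
    by rewrite sum_delta // mulN1r subrr.
  rewrite -[RHS]d'0 /d' mulN1r -[d e in RHS](sum_delta xpredT e us ds) -sumrB.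
  by apply: eq_bigr => y _; rewrite mulrBl mulrC [h y e * _]mulrC.
- suff -> : h e e = 0 by rewrite eqxx subr0.
  apply: (indep_dep_eq0 indB (proj1 (hP e I))) => x NBx.
  by rewrite (proj2 (hP e I)) //; case: eqVneq NBx => [->|].
move=> x [d [Dd dB]].
have : d e + -1 * h x e = 0.
  apply: (indep_dep_eq0 indB (dep_lin spaceD (-1) Dd (proj1 (hP x I)))) => y NBy.
  rewrite dB; last by case.
  by rewrite (proj2 (hP x I)) // mulN1r subrr.
by rewrite mulN1r dB => [->|[_ /(_ erefl)]].
Qed.

(** Pairing with the fundamental circuits of a base that avoids [X] shows that
    only 0 is carried by [X]; if there is no such base, a fundamental cocircuit is
    carried by [X]. *)
Lemma indep_annihilatorP X : indep_of_dependences (annihilator D) X <->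
  exists B, maximal_in ind B /\ B `<=` ~` X.
Proof.
split=> [indX|[B [maxB BX]] [c [Cc c0 cX]]].
  have [I maxI] := dep_maximal (@sub0set _ (~` X)) dep_set0.
  have [[indI _ IX] _] := maxI.
  have [B [[indB IB _] maxB]] := dep_maximal (@subsetT _ I) indI.
  have {}maxB : maximal_in ind B.
    split=> // Y indY BY; apply: maxB => //; split=> //.
    exact: subset_trans BY.
  exists B; split=> // e Be Xe.
  have [c [Cc ce cB]] := fundamental_cocircuit maxB Be.
  apply: indX; exists c; split=> //.
    by move=> c0; move: ce; rewrite c0 => /esym/eqP; rewrite oner_eq0.
  move=> x NXx; apply: cB; apply: (@spans_mono I).
    by move=> y Iy; split; [exact: IB | move=> ye; apply: (IX y); rewrite // ye].
  exact: spans_maximal maxI _ NXx.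
apply: c0; apply/funext => e.
have [Xe|/cX //] := pselect (X e).
have [d [Dd dB]] := spans_base maxB e.
have := Cc d Dd; rewrite (@fsum_seq _ _ _ [:: e]) //.
  by rewrite big_seq1 dB ?eqxx ?mulr1 // => /BX.
move=> x; rewrite inE; apply: contra_neqT => xe.
have [Xx|/cX ->] := pselect (X x); last by rewrite mul0r.
by rewrite dB ?(negbTE xe) ?mulr0 // => /BX.
Qed.

End Space.
End DependenceSpace.

(** * Linear and thin dependences *)

Section Representation.
Variables (k : fieldType) (E : choiceType).

(** Unlike [linear_dependence phi], this excludes functions with infinitely many
    nonzero values on the zero set of [phi]. *)
Definition finite_dependence (V : lmodType k) (phi : E -> V) : set (E -> k) :=
  [set d | finite_set [set e | d e != 0] /\
           \sum_(e \in [set: E]) d e *: phi e = 0].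

Lemma finite_dependence_space (V : lmodType k) (phi : E -> V) :
  dependence_space (finite_dependence phi).
Proof.
split=> [d []//||a d d' [fd sd] [fd' sd']].
  split; last by rewrite fsbig1 // => e _; rewrite scale0r.
  by apply: sub_finite_set (finite_set0 E) => e /=; rewrite eqxx.
have [s1 [_ ds]] := support_seq fd.
have [s2 [_ ds']] := support_seq fd'.
pose s := undup (s1 ++ s2); have us : uniq s := undup_uniq _.
have sP e : (d e != 0) || (d' e != 0) -> e \in s.
  by rewrite mem_undup mem_cat => /orP[/ds|/ds'] ->; rewrite ?orbT.
have lcs e : d e + a * d' e != 0 -> e \in s.
  move=> de; apply: sP; move: de; apply: contraR.
  by rewrite negb_or !negbK => /andP[/eqP-> /eqP->]; rewrite mulr0 addr0.
split; first exact: (sub_finite_set lcs (finite_seq s)).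
have sumE (c : E -> k) : (forall e, c e != 0 -> e \in s) ->
    \sum_(e \in [set: E]) c e *: phi e = \sum_(e <- s) c e *: phi e.
  move=> cs; apply: fsum_seq => // e; rewrite scaler_eq0 negb_or.
  by case/andP => /cs.
rewrite sumE //; under eq_bigr do rewrite scalerDl -scalerA.
rewrite big_split /= -scaler_sumr -!sumE ?sd ?sd' ?scaler0 ?addr0 // => e de.
  by apply: sP; rewrite de orbT.
by apply: sP; rewrite de.
Qed.

(** A dependence that is not finitely supported is nonzero at some [e] with
    [phi e = 0], and then the indicator of [e] is a finitely supported
    dependence with smaller support. *)
Lemma linear_indepE (V : lmodType k) (phi : E -> V) :
  linear_indep phi = indep_of_dependences (finite_dependence phi).
Proof.
apply/seteqP; split=> X indX [c [depc c0 cX]]; apply: indX; last first.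
  have [fc sc] := depc.
  have [[e [ce pe]]|Nloop] := pselect (exists e, c e != 0 /\ phi e = 0).
    exists (fun x => (x == e)%:R); split.
    - split.
        apply: (sub_finite_set _ (finite_set1 e)) => x /=.
        by case: (eqVneq x e) => //; rewrite mulr0n eqxx.
      rewrite fsbig1 // => x _.
      by case: eqVneq => [->|_]; rewrite ?pe ?scaler0 ?scale0r.
    - move=> /(congr1 (@^~ e)) /eqP.
      by rewrite /= eqxx oner_eq0.
    - move=> x NXx; case: eqVneq => // xe; move: ce.
      by rewrite cX ?eqxx // -xe.
  exists c; split=> //; split=> //; apply: sub_finite_set fc => e /= ce.
  rewrite scaler_eq0 negb_or ce /=; apply/eqP => pe; apply: Nloop.
  by exists e.
exists c; case: depc => fc sc; split=> //; split=> //.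
apply: sub_finite_set fc => e /=; by rewrite scaler_eq0 negb_or => /andP[].
Qed.

(** Indexing by the dependences themselves makes [f] thin, because each of them
    has finite support. *)
Lemma thin_dependence_annihilator (V : lmodType k) (phi : E -> V) :
  let D := finite_dependence phi in
  let f e (d : {d | D d}) := sval d e in
  thin f /\ thin_dependence f = annihilator D.
Proof.
move=> D f; split=> [[d [fd _]] //|].
apply/seteqP; split=> c Cc.
  by move=> d Dd; have [_] := Cc (exist _ d Dd).
move=> [d Dd]; split; last exact: Cc.
apply: sub_finite_set (proj1 Dd) => e /=.
by rewrite mulf_eq0 negb_or => /andP[].
Qed.

(** Take the evaluations [phi e] in [k^C], where [C] is the space of thin
    dependences.  The double orthogonal of [C] is no larger than [C] because [C]
    is itself the orthogonal of the finitely supported [fun e => f e a]. *)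
Lemma annihilator_thin_dependence (A : Type) (f : E -> A -> k) : thin f ->
  exists (V : lmodType k) (phi : E -> V),
    annihilator (finite_dependence phi) = thin_dependence f.
Proof.
move=> thinf; pose C := {c : E -> k | thin_dependence f c}.
pose phi (e : E) : C -> k^o := fun c => sval c e.
exists (C -> k^o : lmodType k), phi; apply/seteqP; split=> c Cc; last first.
  move=> d [fd sd]; have [s [us ds]] := support_seq fd.
  have {}sd : \sum_(e <- s) d e *: phi e = 0.
    rewrite -[RHS]sd (fsum_seq us) // => e.
    by rewrite scaler_eq0 negb_or => /andP[/ds].
  have := congr1 (@^~ (exist _ c Cc : C)) sd; rewrite /= fct_sumE /= => cd0.
  rewrite (fsum_seq us); last first.
    by move=> e; rewrite mulf_eq0 negb_or => /andP[_ /ds].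
  by rewrite -[RHS]cd0; apply: eq_bigr => e _; rewrite mulrC.
move=> a; split.
  by apply: sub_finite_set (thinf a) => e /=; rewrite mulf_eq0 negb_or => /andP[].
apply: Cc; split; first exact: thinf.
have [s [us fs]] := support_seq (thinf a).
rewrite (fsum_seq us); last by move=> e; rewrite scaler_eq0 negb_or => /andP[/fs].
apply/funext => -[c' Cc']; rewrite fct_sumE /=.
have [_] := Cc' a; rewrite (fsum_seq us).
  by move=> cs0; apply: etrans cs0; apply: eq_bigr => e _; exact: mulrC.
by move=> e; rewrite mulf_eq0 negb_or => /andP[_ /fs].
Qed.

End Representation.

(** * Duality in terms of independent sets *)

Lemma is_dual_ofP (E : Type) (M N : matroid E) :
  is_dual_of M N <->
  forall X, indep M X <-> exists B, base N B /\ B `<=` ~` X.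
Proof.
have extend X : indep M X -> exists B, base M B /\ X `<=` B.
  move=> indX; have [B [[indB XB _] maxB]] := indep_maximal (@subsetT _ X) indX.
  exists B; split=> //; split=> // Y indY BY; apply: maxB => //; split=> //.
  exact: subset_trans BY.
split=> [dualMN X|indM].
  split=> [/extend[B [baseB XB]]|[B [baseB BX]]].
    exists (~` B); split; last exact: subsetC.
    by move: baseB; rewrite dualMN.
  have : base M (~` B) by rewrite dualMN /= setCK.
  by case=> indB _; apply: indep_subset indB; rewrite -[X]setCK; exact: subsetC.
apply/seteqP; split=> X.
  move=> [/indM[B [baseB BX]] maxX] /=.
  have {}BX : X `<=` ~` B by rewrite -[X]setCK; exact: subsetC.
  rewrite -(maxX (~` B)) ?setCK //; apply/indM.
  by exists B; split=> //; rewrite setCK.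
move=> baseX; split; first by apply/indM; exists (~` X); split.
move=> Y /indM[B [[indB maxB] BY]] XY.
have BX : B `<=` ~` X by apply: subset_trans BY _; exact: subsetC.
have NXB := maxB _ (proj1 baseX) BX.
by apply/seteqP; split=> //; rewrite -[X]setCK NXB -[Y]setCK; exact: subsetC.
Qed.

Theorem theorem1p2 (k : fieldType) (E : choiceType) (M : matroid E) :
  (exists (A : Type) (f : E -> A -> k),
     thin f /\ indep M = thin_sums_system f)
  <-> (exists N : matroid E, representable k N /\ is_dual_of M N).
Proof.
split=> [[A [f [thinf indM]]]|[N [[V [phi indN]] dualMN]]].
  have [V [phi annE]] := annihilator_thin_dependence thinf.
  exists (dependence_matroid (finite_dependence_space phi)); split.
    by exists V, phi; rewrite linear_indepE.
  apply/is_dual_ofP => X; rewrite indM /thin_sums_system -annE.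
  exact: indep_annihilatorP (finite_dependence_space phi) X.
have [thinf depf] := thin_dependence_annihilator phi.
eexists _, _; split; first exact: thinf.
have dualP := proj1 (is_dual_ofP M N) dualMN.
rewrite /base indN linear_indepE in dualP.
have annP := indep_annihilatorP (finite_dependence_space phi).
apply/seteqP; split=> X; rewrite /thin_sums_system depf.
  by move/dualP/annP.
by move/annP/dualP.
Qed.
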